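(* Let $\Gamma$ be a groupoid, $R$ a $\Gamma$-graded ring, $S$ a $\Gamma_0$-simple $\Gamma$-graded $R$-module, $D:=\mathrm{END}_R(S)$ and $\Gamma_0':=\Gamma_0'(D)=\Gamma_0'(S)$. The following assertions hold: (1) $D$ is a gr-division ring. (2) Consider the gr-primality relation $\sim$ defined on $\Gamma_0'$ by $e\sim f$ iff $1_eD1_f\ne0$. Then $e\sim f$ in $\Gamma_0'$ if and only if $S(e)$ and $S(f)$ are in the same isoshift class. (3) There exists a bijection between $\Gamma_0'/{\sim}$ and the set of isoshift classes of $\{S(e):e\in\Gamma_0'\}$ that sends each $[e]\in\Gamma_0'/{\sim}$ to the isoshift class of $S(e)$. (4) $D$ is a gr-prime (resp. gr-simple) ring if and only if all $S(e)$, $e\in\Gamma_0'$, are in the same isoshift class.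
   Context: A groupoid $\Gamma$ is a small category with all morphisms invertible, identified with its set of morphisms; $\Gamma_0$ is its set of objects (identified with identity morphisms). For $\gamma:e\to f$ write $d(\gamma)=e$, $r(\gamma)=f$; $\delta\gamma$ is defined iff $d(\delta)=r(\gamma)$. A $\Gamma$-graded ring is an associative ring $R=\bigoplus_{\gamma\in\Gamma}R_\gamma$ (additive subgroups) with $R_\gamma R_\delta\subseteq R_{\gamma\delta}$ if $\gamma\delta$ is defined and $R_\gamma R_\delta=0$ otherwise, assumed object unital: for each $e\in\Gamma_0$, $R_e$ is a unital ring with identity $1_e$ (possibly $1_e=0$) and $1_{r(\gamma)}a=a=a1_{d(\gamma)}$ for $a\in R_\gamma$. $\Gamma_0'(R)=\{e\in\Gamma_0:1_e\neq0\}$. A $\Gamma$-graded $R$-module is a right $R$-module $M=\bigoplus_\gamma M_\gamma$ with $M_\gamma R_\delta\subseteq M_{\gamma\delta}$ (zero if undefined) and $MR=M$. For $\sigma\in\Gamma$, the shift $M(\sigma)$ is the graded module with $M(\sigma)_\gamma=M_{\sigma\gamma}$ ($0$ if $\sigma\gamma$ is undefined); in particular $M(e)=\bigoplus_{r(\gamma)=e}M_\gamma$ for $e\in\Gamma_0$. $\Gamma_0'(M)=\{e\in\Gamma_0:M(e)\neq0\}$. $\cong_{gr}$ means there is a degree-preserving isomorphism. A graded module is gr-simple if nonzero with only graded submodules $0$ and itself; $S$ is $\Gamma_0$-simple if $S(e)$ is gr-simple for each $e\in\Gamma_0'(S)$. Two gr-simple graded modules $M,N$ are in the same isoshift class iff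 $M\cong_{gr}N(\sigma)$ for some $\sigma\in\Gamma$ (an equivalence relation). $\mathrm{END}_R(M)=\bigoplus_\gamma\mathrm{END}_R(M)_\gamma$, where $\mathrm{END}_R(M)_\gamma$ is the group of $R$-module endomorphisms $g$ of $M$ with $g(M_\sigma)\subseteq M_{\gamma\sigma}$ for all $\sigma$ ($M_{\gamma\sigma}=0$ if undefined). Under composition it is an (object unital) $\Gamma$-graded ring, whose $1_e$ is the projection $M\to M(e)$, and $\Gamma_0'(\mathrm{END}_R(M))=\Gamma_0'(M)$. A gr-division ring is a $\Gamma$-graded ring $D\neq0$ such that each nonzero $a\in D_\gamma$ has $a^{-1}\in D_{\gamma^{-1}}$ with $aa^{-1}=1_{r(\gamma)}$, $a^{-1}a=1_{d(\gamma)}$. A graded ring is gr-simple if it is nonzero and its only graded two-sided ideals are $0$ and itself; gr-prime if the product of any two nonzero graded ideals is nonzero.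
   Formalization: The module S is assumed nonzero: by the stated definition S = 0 is vacuously Γ_0-simple, but then D = 0 is neither a gr-division ring nor gr-simple, so (1) and the gr-simple half of (4) would fail. *)

(* Defs.v *)
From HB Require Import structures.
From mathcomp Require Import all_boot all_algebra.
From mathcomp Require Import mathcomp_extra boolp classical_sets functions.

Set Implicit Arguments.
Unset Strict Implicit.
Unset Printing Implicit Defensive.

Import GRing.Theory.
Local Open Scope classical_set_scope.
Local Open Scope ring_scope.

(* Equivalence relations, quotients and bijections relative to subsets; a class
   is the predicate of its members. Subsets are plain predicates rather than
   [set T], since types of graded modules do not fit in the universe of [set]. *)

Definition equiv_on (T : Type) (A : T -> Prop) (r : T -> T -> Prop) : Prop :=
  [/\ forall x, A x -> r x x,
      forall x y, A x -> A y -> r x y -> r y x &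
      forall x y z, A x -> A y -> A z -> r x y -> r y z -> r x z].

Definition eqclass (T : Type) (A : T -> Prop) (r : T -> T -> Prop) (x : T) :
  T -> Prop := fun y => A y /\ r x y.

Definition image_of (T U : Type) (A : T -> Prop) (f : T -> U) : U -> Prop :=
  fun y => exists2 x, A x & f x = y.

Definition quotient_by (T : Type) (A : T -> Prop) (r : T -> T -> Prop) :
  (T -> Prop) -> Prop := image_of A (eqclass A r).

Definition bij_on (T U : Type) (A : T -> Prop) (B : U -> Prop) (f : T -> U) : Prop :=
  [/\ forall x, A x -> B (f x),
      forall x y, A x -> A y -> f x = f y -> x = y &
      forall y, B y -> exists2 x, A x & f x = y].

Definition subgroup (V : zmodType) (A : set V) : Prop :=
  A 0 /\ forall x y, A x -> A y -> A (x - y).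

Definition sumset (I : choiceType) (V : zmodType) (F : I -> set V) : set V :=
  [set x | exists (s : seq I) (f : I -> V),
     (forall i, F i (f i)) /\ x = \sum_(i <- s) f i].

Definition independent (I : choiceType) (V : zmodType) (F : I -> set V) : Prop :=
  forall (s : seq I) (f : I -> V), uniq s -> (forall i, F i (f i)) ->
    \sum_(i <- s) f i = 0 -> forall i, i \in s -> f i = 0.

Definition is_direct_sum (I : choiceType) (V : zmodType) (F : I -> set V) : Prop :=
  [/\ forall i, subgroup (F i), forall x, sumset F x & independent F].

Section SubgroupTheory.
Variables (V : zmodType) (A : set V).
Hypothesis sgA : subgroup A.

Lemma subgroup0 : A 0. Proof. by case: sgA. Qed.

Lemma subgroupN x : A x -> A (- x).
Proof. by move=> Ax; rewrite -(add0r (- x)); apply: sgA.2 => //; apply: subgroup0. Qed.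

Lemma subgroupD x y : A x -> A y -> A (x + y).
Proof. by move=> Ax Ay; rewrite -(opprK y); apply: sgA.2 => //; apply: subgroupN. Qed.

Lemma subgroup_sum (J : Type) (s : seq J) (f : J -> V) :
  (forall i, A (f i)) -> A (\sum_(i <- s) f i).
Proof.
move=> Af; elim/big_ind: _ => //; first exact: subgroup0.
by move=> x y; apply: subgroupD.
Qed.

Lemma subgroupMn x n : A x -> A (x *+ n).
Proof.
move=> Ax; elim: n => [|n IHn]; first by rewrite mulr0n; apply: subgroup0.
by rewrite mulrS; apply: subgroupD.
Qed.

End SubgroupTheory.

Section SumsetTheory.
Variables (I : choiceType) (V : zmodType).
Implicit Types (F : I -> set V) (P : set I).

Lemma sumset_uniq F x : (forall i, subgroup (F i)) -> sumset F x ->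
  exists (s : seq I) (f : I -> V),
    [/\ uniq s, forall i, F i (f i) & x = \sum_(i <- s) f i].
Proof.
move=> sgF [s [f [Ff ->]]].
exists (undup s), (fun i => f i *+ count_mem i s); split.
- exact: undup_uniq.
- by move=> i; apply: subgroupMn.
- by rewrite -big_undup_iterop_count.
Qed.

Lemma sumset_ind F (Q : V -> Prop) : Q 0 ->
  (forall x y, Q x -> Q y -> Q (x + y)) -> (forall i x, F i x -> Q x) ->
  forall x, sumset F x -> Q x.
Proof.
move=> Q0 QD QF x [s [f [Ff ->]]].
elim/big_ind: _ => // i _; exact: QF (Ff i).
Qed.

Lemma sumset_in F i x : (forall j, subgroup (F j)) -> F i x -> sumset F x.
Proof.
move=> sgF Fx; exists [:: i], (fun j => if j == i then x else 0); split.
  by move=> j; case: eqP => [->|] //; have [] := sgF j.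
by rewrite big_seq1 eqxx.
Qed.

Lemma sumset_subgroup F : (forall i, subgroup (F i)) -> subgroup (sumset F).
Proof.
move=> sgF; split.
  by exists [::], (fun=> 0); rewrite big_nil; split=> // i; have [] := sgF i.
move=> x y /(sumset_uniq sgF) [s [f [us Ff ->]]] /(sumset_uniq sgF) [t [g [ut Fg ->]]].
exists (undup (s ++ t)),
  (fun i => (if i \in s then f i else 0) - (if i \in t then g i else 0)); split.
  by move=> i; apply: (sgF i).2; case: ifP => // _; have [] := sgF i.
rewrite sumrB -!big_mkcond /=; congr (_ - _).
  rewrite -[RHS]big_filter; apply: perm_big; apply: uniq_perm => //.
    exact/filter_uniq/undup_uniq.
  by move=> i; rewrite mem_filter mem_undup mem_cat; case: (i \in s).
rewrite -[RHS]big_filter; apply: perm_big; apply: uniq_perm => //.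
  exact/filter_uniq/undup_uniq.
by move=> i; rewrite mem_filter mem_undup mem_cat orbC; case: (i \in t).
Qed.

Definition restrict P F (i : I) : set V := [set x | x = 0 \/ P i /\ F i x].

Lemma restrict_subgroup P F : (forall i, subgroup (F i)) ->
  forall i, subgroup (restrict P F i).
Proof.
move=> sgF i; split; first by left.
move=> x y [->|[Pi Fx]] [->|[Pi' Fy]].
- by left; rewrite subr0.
- by right; split=> //; rewrite sub0r; apply: subgroupN.
- by right; split=> //; rewrite subr0.
- by right; split=> //; apply: (sgF i).2.
Qed.

Lemma restrict_sumset_subgroup P F : (forall i, subgroup (F i)) ->
  subgroup (sumset (restrict P F)).
Proof. by move=> sgF; apply/sumset_subgroup/restrict_subgroup. Qed.

Lemma restrict_sub P F i x : (forall i, subgroup (F i)) ->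
  restrict P F i x -> F i x.
Proof. by move=> sgF [->|[]//]; have [] := sgF i. Qed.

Lemma restrict_capC P F x : (forall i, subgroup (F i)) -> independent F ->
  sumset (restrict P F) x -> sumset (restrict (~` P) F) x -> x = 0.
Proof.
move=> sgF indF.
move=> /(sumset_uniq (restrict_subgroup P sgF)) [s [f [us Ff xE]]].
move=> /(sumset_uniq (restrict_subgroup (~` P) sgF)) [t [g [ut Fg xE']]].
have f0 i : i \in s -> f i = 0.
  pose h i := (if i \in s then f i else 0) - (if i \in t then g i else 0).
  have Fh j : F j (h j).
    apply: (sgF j).2; case: ifP => _; try by have [] := sgF j.
      exact: restrict_sub (Ff j).
    exact: restrict_sub (Fg j).
  have h0 : \sum_(i <- undup (s ++ t)) h i = 0.
    rewrite /h sumrB -!big_mkcond /=.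
    rewrite -[X in X - _]big_filter -[X in _ - X]big_filter.
    rewrite (perm_big s) /=; last first.
      apply: uniq_perm => //; first exact/filter_uniq/undup_uniq.
      by move=> j; rewrite mem_filter mem_undup mem_cat; case: (j \in s).
    rewrite -xE (perm_big t) /= -?xE' ?subrr//.
    apply: uniq_perm => //; first exact/filter_uniq/undup_uniq.
    by move=> j; rewrite mem_filter mem_undup mem_cat orbC; case: (j \in t).
  move=> si; have := indF _ h (undup_uniq _) Fh h0 i.
  rewrite mem_undup mem_cat si /h si => /(_ isT).
  case: (Ff i) => [->//|[Pi _]]; case: ifP => _; rewrite ?subr0//.
  by case: (Fg i) => [->|[]//]; rewrite subr0.
by rewrite xE big_seq big1.
Qed.

Lemma restrict_split P F x : (forall i, subgroup (F i)) -> sumset F x ->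
  exists y, sumset (restrict P F) y /\ sumset (restrict (~` P) F) (x - y).
Proof.
move=> sgF hx; elim/sumset_ind: hx => {x}.
- exists 0; rewrite subr0; split; exact: (subgroup0 (restrict_sumset_subgroup _ sgF)).
- move=> x x' [y [y1 y2]] [y' [y'1 y'2]]; exists (y + y'); split.
    exact: (subgroupD (restrict_sumset_subgroup _ sgF)).
  rewrite opprD addrACA.
  exact: (subgroupD (restrict_sumset_subgroup _ sgF)).
- move=> i x Fx; have [Pi|nPi] := pselect (P i).
    exists x; rewrite subrr; split; last exact: (subgroup0 (restrict_sumset_subgroup _ sgF)).
    by apply: (sumset_in (restrict_subgroup P sgF) (i := i)); right.
  exists 0; rewrite subr0; split; first exact: (subgroup0 (restrict_sumset_subgroup _ sgF)).
  by apply: (sumset_in (restrict_subgroup (~` P) sgF) (i := i)); right.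
Qed.

(* The projection of V = (+)_i F i onto (+)_(i | P i) F i.                     *)
Definition dproj P F (x : V) : V :=
  xget 0 [set y | sumset (restrict P F) y /\ sumset (restrict (~` P) F) (x - y)].

Lemma dproj_spec P F x : is_direct_sum F ->
  sumset (restrict P F) (dproj P F x) /\
  sumset (restrict (~` P) F) (x - dproj P F x).
Proof.
case=> sgF spF _; have [y hy] := restrict_split P sgF (spF x).
by rewrite /dproj; case: xgetP => [z _ //|/(_ y)].
Qed.

Lemma dproj_eq P F x y : is_direct_sum F ->
  sumset (restrict P F) y -> sumset (restrict (~` P) F) (x - y) ->
  dproj P F x = y.
Proof.
move=> dF y1 y2; have [z1 z2] := dproj_spec P x dF; have [sgF _ indF] := dF.
apply/eqP; rewrite -subr_eq0; apply/eqP; apply: (restrict_capC (P := P) sgF indF).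
  exact: (sumset_subgroup (restrict_subgroup P sgF)).2.
have := (sumset_subgroup (restrict_subgroup (~` P) sgF)).2 _ _ y2 z2.
by rewrite opprB addrC addrA subrK.
Qed.

Lemma dprojD P F x y : is_direct_sum F ->
  dproj P F (x + y) = dproj P F x + dproj P F y.
Proof.
move=> dF; have [x1 x2] := dproj_spec P x dF; have [y1 y2] := dproj_spec P y dF.
have [sgF _ _] := dF; apply: dproj_eq => //.
  exact: (subgroupD (restrict_sumset_subgroup _ sgF)).
rewrite opprD addrACA.
exact: (subgroupD (restrict_sumset_subgroup _ sgF)).
Qed.

Lemma dproj_id P F i x : is_direct_sum F -> P i -> F i x -> dproj P F x = x.
Proof.
move=> dF Pi Fx; have [sgF _ _] := dF; apply: dproj_eq => //.
  by apply: (sumset_in (restrict_subgroup P sgF) (i := i)); right.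
rewrite subrr; exact: (subgroup0 (restrict_sumset_subgroup _ sgF)).
Qed.

Lemma dproj_0 P F i x : is_direct_sum F -> ~ P i -> F i x -> dproj P F x = 0.
Proof.
move=> dF Pi Fx; have [sgF _ _] := dF; apply: dproj_eq => //.
  exact: (subgroup0 (restrict_sumset_subgroup _ sgF)).
rewrite subr0.
by apply: (sumset_in (restrict_subgroup (~` P) sgF) (i := i)); right.
Qed.

End SumsetTheory.

(* F i for a defined index i, and 0 for an undefined one.                     *)
Definition ohom (I : choiceType) (V : zmodType) (F : I -> set V)
  (i : option I) : set V := if i is Some j then F j else [set 0].

Lemma ohom_subgroup (I : choiceType) (V : zmodType) (F : I -> set V) i :
  (forall j, subgroup (F j)) -> subgroup (ohom F i).
Proof.
by move=> sgF; case: i => [j|] //=; split=> // x y -> ->; rewrite subr0.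
Qed.

Lemma ohom_independent (I J : choiceType) (V : zmodType) (F : J -> set V)
    (phi : I -> option J) :
  (forall j, subgroup (F j)) -> independent F ->
  (forall i i' j, phi i = Some j -> phi i' = Some j -> i = i') ->
  independent (fun i => ohom F (phi i)).
Proof.
move=> sgF indF inj s f us Ff f0 i si.
case Ei: (phi i) => [j|]; last by have := Ff i; rewrite Ei.
pose g (k : J) := \sum_(i' <- s | phi i' == Some k) f i'.
have Fg k : F k (g k).
  rewrite /g; elim/big_ind: _; first by have [] := sgF k.
    by move=> x y; apply: subgroupD.
  by move=> i' /eqP E; have := Ff i'; rewrite E.
have ut : uniq (undup (pmap phi s)) by exact: undup_uniq.
have g0 : \sum_(k <- undup (pmap phi s)) g k = 0.
  rewrite -[RHS]f0 /g (exchange_big_dep xpredT)//= big_seq [RHS]big_seq.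
  apply: eq_bigr => i' si'; case E: (phi i') => [k|]; last first.
    rewrite big1 //.
    by have := Ff i'; rewrite E.
  rewrite (eq_bigl (pred1 k)); last by move=> k' /=; rewrite eq_sym; apply/eqP/eqP=> [[]|->].
  rewrite -big_filter (perm_big [:: k]) ?big_seq1//.
  apply: uniq_perm => //; first exact: filter_uniq.
  move=> k'; rewrite mem_filter /= inE mem_undup.
  case: eqP => //= ->; rewrite mem_pmap; apply/mapP; by exists i'.
have := indF _ g ut Fg g0 j.
rewrite mem_undup mem_pmap -Ei map_f // => /(_ isT) <-.
rewrite /g -big_filter (perm_big [:: i]) ?big_seq1//.
apply: uniq_perm => //; first exact: filter_uniq.
move=> i'; rewrite mem_filter inE; apply/andP/eqP => [[/eqP E _]|->].
  exact: inj E Ei.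
by rewrite Ei eqxx.
Qed.

Record subgroup_family (I : choiceType) (V : zmodType) := SubgroupFamily {
  sgfam :> I -> set V;
  sgfamP : forall i, subgroup (sgfam i) }.

Section SumType.
Variables (I : choiceType) (V : zmodType) (F : subgroup_family I V).

Definition sumpred : {pred V} := fun x => `[< sumset F x >].

Lemma sumpred_zmod_closed : zmod_closed sumpred.
Proof.
have [F0 FB] := sumset_subgroup (@sgfamP _ _ F).
by split=> [|x y /asboolP xF /asboolP yF]; apply/asboolP => //; apply: FB.
Qed.
HB.instance Definition _ := GRing.isZmodClosed.Build V sumpred sumpred_zmod_closed.

(* The subgroup \sum_i F i, as an abelian group of its own.                   *)
Record sumtype := Sumtype { sumval : V; sumvalP : sumval \in sumpred }.
HB.instance Definition _ := [isSub for sumval].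
HB.instance Definition _ := [Choice of sumtype by <:].
HB.instance Definition _ := [SubChoice_isSubZmodule of sumtype by <:].

Definition sumtype_hom (i : I) : set sumtype := [set u | F i (val u)].

Lemma sumtype_sumset (u : sumtype) : sumset F (val u).
Proof. exact/asboolP/(valP u). Qed.

Lemma sumtype_in i x : F i x -> x \in sumpred.
Proof. by move=> Fx; apply/asboolP/(sumset_in (@sgfamP _ _ F) Fx). Qed.

Lemma sumtype_hom_subgroup i : subgroup (sumtype_hom i).
Proof.
have [F0 FB] := sgfamP F i; split; first by rewrite /sumtype_hom /mkset raddf0.
by move=> x y Fx Fy; rewrite /sumtype_hom /mkset raddfB; apply: FB.
Qed.

Lemma sumtype_direct : independent F -> is_direct_sum sumtype_hom.
Proof.
move=> indF; split; first exact: sumtype_hom_subgroup.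
- move=> u; have [s [f [Ff uE]]] := sumtype_sumset u.
  exists s, (fun i => Sumtype (sumtype_in (Ff i))); split=> //.
  by apply: val_inj; rewrite uE raddf_sum.
- move=> s f us Ff f0 i si; apply: val_inj; rewrite raddf0.
  apply: (indF s (fun i => val (f i)) us) => //.
  by rewrite -raddf_sum f0 raddf0.
Qed.

Lemma sumtype_ind (Q : sumtype -> Prop) : Q 0 ->
  (forall x y, Q x -> Q y -> Q (x + y)) ->
  (forall i x, sumtype_hom i x -> Q x) -> forall x, Q x.
Proof.
move=> Q0 QD QF u; have [s [f [Ff uE]]] := sumtype_sumset u.
have -> : u = \sum_(i <- s) Sumtype (sumtype_in (Ff i)).
  by apply: val_inj; rewrite uE raddf_sum.
by elim/big_ind: _ => // i _; apply: (QF i); exact: Ff.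
Qed.

End SumType.

(* Groupoids. The product [gmul b a] of the morphisms a : e -> f and
   b : f' -> g is [Some _] when f = f', and [None] otherwise. Asking for choice
   types is no restriction, as every type has such a structure classically.    *)
Record groupoid := Groupoid {
  gob : choiceType;
  gmor :> choiceType;
  gdom : gmor -> gob;
  gcod : gmor -> gob;
  gid : gob -> gmor;
  gmul : gmor -> gmor -> option gmor;
  ginv : gmor -> gmor;
  gdom_id : forall e, gdom (gid e) = e;
  gcod_id : forall e, gcod (gid e) = e;
  gmul_defined : forall b a, gmul b a <> None <-> gdom b = gcod a;
  gdom_mul : forall b a c, gmul b a = Some c -> gdom c = gdom a;
  gcod_mul : forall b a c, gmul b a = Some c -> gcod c = gcod b;
  gmulA : forall c b a,
    obind (gmul c) (gmul b a) = obind (fun cb => gmul cb a) (gmul c b);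
  gmul1l : forall a, gmul (gid (gcod a)) a = Some a;
  gmul1r : forall a, gmul a (gid (gdom a)) = Some a;
  gmulVl : forall a, gmul (ginv a) a = Some (gid (gdom a));
  gmulVr : forall a, gmul a (ginv a) = Some (gid (gcod a)) }.

Section GroupoidTheory.
Variable G : groupoid.
Implicit Types a b c : G.

Lemma gmul_injl c a b d : gmul c a = Some d -> gmul c b = Some d -> a = b.
Proof.
have K x : gmul c x = Some d -> gmul (ginv c) d = Some x.
  move=> E; have := gmulA (ginv c) c x; rewrite E gmulVl /= => ->.
  have -> : gdom c = gcod x by apply/gmul_defined; rewrite E.
  exact: gmul1l.
by move=> /K E /K; rewrite E => -[].
Qed.

Lemma gmul_injr c a b d : gmul a c = Some d -> gmul b c = Some d -> a = b.
Proof.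
have K x : gmul x c = Some d -> gmul d (ginv c) = Some x.
  move=> E; have := gmulA x c (ginv c); rewrite E gmulVr /= => <-.
  have <- : gdom x = gcod c by apply/gmul_defined; rewrite E.
  exact: gmul1r.
by move=> /K E /K; rewrite E => -[].
Qed.

Lemma gmul_None b a : gdom b <> gcod a -> gmul b a = None.
Proof.
by move=> ne; case E: (gmul b a) => [c|] //; case: ne; apply/gmul_defined; rewrite E.
Qed.

End GroupoidTheory.

(* Object unital graded rings. They need not have a unit, and so are abelian
   groups with a biadditive associative product rather than a pzRingType.      *)
Record grRing (G : groupoid) := GrRing {
  rsort :> zmodType;
  rmul : rsort -> rsort -> rsort;
  rmulA : associative rmul;
  rmulDl : left_distributive rmul +%R;
  rmulDr : right_distributive rmul +%R;
  rhom : G -> set rsort;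
  rhom_direct : is_direct_sum rhom;
  rhom_mul : forall (g h : G) a b,
    rhom g a -> rhom h b -> ohom rhom (gmul g h) (rmul a b);
  rone : gob G -> rsort;
  rone_hom : forall e, rhom (gid e) (rone e);
  rone_mull : forall (g : G) a, rhom g a -> rmul (rone (gcod g)) a = a;
  rone_mulr : forall (g : G) a, rhom g a -> rmul a (rone (gdom g)) = a }.

(* [mact_unital] is the condition MR = M.                                     *)
Record grModule (G : groupoid) (R : grRing G) := GrModule {
  msort :> zmodType;
  mact : msort -> R -> msort;
  mactA : forall m a b, mact (mact m a) b = mact m (rmul a b);
  mactDl : forall m n a, mact (m + n) a = mact m a + mact n a;
  mactDr : forall m a b, mact m (a + b) = mact m a + mact m b;
  mhom : G -> set msort;
  mhom_direct : is_direct_sum mhom;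
  mhom_act : forall (g h : G) m a,
    mhom g m -> rhom h a -> ohom mhom (gmul g h) (mact m a);
  mact_unital : forall m, exists s : seq (msort * R),
    m = \sum_(p <- s) mact p.1 p.2 }.

Section GradedTheory.
Variables (G : groupoid) (R : grRing G).

Section Ring.
Lemma rmul0r (a : R) : rmul 0 a = 0.
Proof. by apply: (addrI (rmul 0 a)); rewrite -rmulDl !addr0. Qed.
Lemma rmulr0 (a : R) : rmul a 0 = 0.
Proof. by apply: (addrI (rmul a 0)); rewrite -rmulDr !addr0. Qed.
Lemma rmul_suml (J : Type) (s : seq J) (f : J -> R) (a : R) :
  rmul (\sum_(j <- s) f j) a = \sum_(j <- s) rmul (f j) a.
Proof.
elim: s => [|j s IHs]; first by rewrite !big_nil rmul0r.
by rewrite !big_cons rmulDl IHs.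
Qed.
Lemma rmul_sumr (J : Type) (s : seq J) (f : J -> R) (a : R) :
  rmul a (\sum_(j <- s) f j) = \sum_(j <- s) rmul a (f j).
Proof.
elim: s => [|j s IHs]; first by rewrite !big_nil rmulr0.
by rewrite !big_cons rmulDr IHs.
Qed.
Lemma rmul_one_ne (g : G) (a : R) e : rhom g a -> gdom g <> e -> rmul a (rone R e) = 0.
Proof.
move=> ga ne; have := rhom_mul ga (rone_hom R e).
by rewrite gmul_None ?gcod_id.
Qed.
End Ring.

Section Module.
Variable M : grModule R.
Lemma mact0r (a : R) : mact (0 : M) a = 0.
Proof. by apply: (addrI (mact 0 a)); rewrite -mactDl !addr0. Qed.
Lemma mactr0 (m : M) : mact m (0 : R) = 0.
Proof. by apply: (addrI (mact m 0)); rewrite -mactDr !addr0. Qed.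
Lemma mact_suml (J : Type) (s : seq J) (f : J -> M) (a : R) :
  mact (\sum_(j <- s) f j) a = \sum_(j <- s) mact (f j) a.
Proof.
elim: s => [|j s IHs]; first by rewrite !big_nil mact0r.
by rewrite !big_cons mactDl IHs.
Qed.
Lemma mact_sumr (J : Type) (s : seq J) (f : J -> R) (m : M) :
  mact m (\sum_(j <- s) f j) = \sum_(j <- s) mact m (f j).
Proof.
elim: s => [|j s IHs]; first by rewrite !big_nil mactr0.
by rewrite !big_cons mactDr IHs.
Qed.

Lemma mhom_subgroup g : subgroup (@mhom _ _ M g).
Proof. by have [] := mhom_direct M. Qed.

Lemma mhom_ind (Q : M -> Prop) : Q 0 ->
  (forall x y, Q x -> Q y -> Q (x + y)) ->
  (forall g x, mhom g x -> Q x) -> forall x, Q x.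
Proof.
move=> Q0 QD QF x; have [_ /(_ x) spM _] := mhom_direct M.
exact: sumset_ind spM.
Qed.

Lemma rhom_ind (Q : R -> Prop) : Q 0 ->
  (forall x y, Q x -> Q y -> Q (x + y)) ->
  (forall g x, rhom g x -> Q x) -> forall x, Q x.
Proof.
move=> Q0 QD QF x; have [_ /(_ x) spR _] := rhom_direct R.
exact: sumset_ind spR.
Qed.

Definition runit (E : seq (gob G)) : R := \sum_(e <- undup E) rone R e.

Lemma runit_hom E (g : G) a : rhom g a -> gdom g \in E -> rmul a (runit E) = a.
Proof.
move=> ga gE; rewrite rmul_sumr (bigD1_seq (gdom g)) ?mem_undup ?undup_uniq//=.
rewrite (rone_mulr ga) big1 ?addr0// => e /eqP ne.
by apply: (rmul_one_ne ga) => /esym.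
Qed.

Lemma mact_runit (m : M) : exists E : seq (gob G), forall E' : seq (gob G), {subset E <= E'} ->
  mact m (runit E') = m.
Proof.
have [s ->] := mact_unital m; elim: s => [|[n a] s [E hE]].
  by exists [::] => E' _; rewrite big_nil mact0r.
have [Ea hEa] : exists E : seq (gob G), forall E' : seq (gob G), {subset E <= E'} -> rmul a (runit E') = a.
  elim/rhom_ind: a => [|x y [E1 h1] [E2 h2]|g x gx].
  - by exists [::] => E' _; rewrite rmul0r.
  - exists (E1 ++ E2) => E' sE'; rewrite rmulDl h1 ?h2// => e he;
    by apply: sE'; rewrite mem_cat he ?orbT.
  - by exists [:: gdom g] => E' sE'; rewrite (runit_hom gx)//; apply: sE'; rewrite inE.
exists (E ++ Ea) => E' sE'; rewrite big_cons mactDl mactA hEa ?hE// => e he;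
by apply: sE'; rewrite mem_cat he ?orbT.
Qed.

End Module.
End GradedTheory.

(* The shift M(g): the subgroup \sum_h M_(g h) of M, where M_(g h) sits in
   degree h. For g = gid e it is the sum of the M_h with gcod h = e.           *)
Section Shift.
Variables (G : groupoid) (R : grRing G) (M : grModule R) (g : G).

Definition shift_family : subgroup_family G M :=
  SubgroupFamily (fun h : G => ohom_subgroup (gmul g h) (@mhom_subgroup _ _ M)).

Lemma shift_family_independent : independent shift_family.
Proof.
have [sgM _ indM] := mhom_direct M.
by apply: ohom_independent => // h h' k; apply: gmul_injl.
Qed.

Lemma shift_family_act (h k : G) m (a : R) : shift_family h m -> rhom k a ->
  ohom shift_family (gmul h k) (mact m a).
Proof.
rewrite /= => hm ka.
case E: (gmul g h) hm => [gh|] /=; last first.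
  move=> ->; rewrite mact0r; case: (gmul h k) => //= hk.
  by have [] := ohom_subgroup (gmul g hk) (@mhom_subgroup _ _ M).
move=> hm; have := mhom_act hm ka.
have := gmulA g h k; rewrite E /= => <-.
by case: (gmul h k).
Qed.

Lemma shift_act_closed (m : M) (a : R) :
  sumset shift_family m -> sumset shift_family (mact m a).
Proof.
have sg := sumset_subgroup (@sgfamP _ _ shift_family).
move=> hm; elim/rhom_ind: a => [|a b ha hb|k a ka].
- by rewrite mactr0; apply: subgroup0.
- by rewrite mactDr; apply: subgroupD.
elim/sumset_ind: hm => [|x y hx hy|h x hx].
- by rewrite mact0r; apply: subgroup0.
- by rewrite mactDl; apply: subgroupD.
have := shift_family_act hx ka; case: (gmul h k) => [hk|] /=.
  exact: (sumset_in (@sgfamP _ _ shift_family)).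
by move=> ->; apply: subgroup0.
Qed.

Local Notation sort := (sumtype shift_family).

Definition shift_act (m : sort) (a : R) : sort :=
  Sumtype (asboolT (shift_act_closed a (sumtype_sumset m))).

Lemma shift_actA m a b : shift_act (shift_act m a) b = shift_act m (rmul a b).
Proof. by apply: val_inj; rewrite /= mactA. Qed.
Lemma shift_actDl m n a : shift_act (m + n) a = shift_act m a + shift_act n a.
Proof. by apply: val_inj; rewrite /= mactDl. Qed.
Lemma shift_actDr m a b : shift_act m (a + b) = shift_act m a + shift_act m b.
Proof. by apply: val_inj; rewrite /= mactDr. Qed.

Lemma shift_hom_act (h k : G) (m : sort) (a : R) :
  sumtype_hom h m -> rhom k a ->
  ohom (sumtype_hom (F := shift_family)) (gmul h k) (shift_act m a).
Proof.
move=> hm ka; have := shift_family_act hm ka.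
case: (gmul h k) => [hk|] //= E; exact: val_inj.
Qed.

Lemma shift_unital (m : sort) : exists s : seq (sort * R),
  m = \sum_(p <- s) shift_act p.1 p.2.
Proof.
have [E hE] := mact_runit (val m); exists [:: (m, runit R E)].
by rewrite big_seq1; apply: val_inj; rewrite /= hE.
Qed.

Definition shift : grModule R :=
  GrModule shift_actA shift_actDl shift_actDr
    (sumtype_direct shift_family_independent) shift_hom_act shift_unital.

End Shift.

(* The graded endomorphism ring END_R(M), as a subgroup of M -> M.            *)
Section End.
Variables (G : groupoid) (R : grRing G) (M : grModule R).

Definition is_endo (f : M -> M) : Prop :=
  (forall x y, f (x + y) = f x + f y) /\
  (forall x (a : R), f (mact x a) = mact (f x) a).

Definition endo_hom (g : G) : set (M -> M) :=
  [set f | is_endo f /\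
     forall (h : G) x, mhom h x -> ohom (@mhom _ _ M) (gmul g h) (f x)].

Lemma endo0 f : is_endo f -> f 0 = 0.
Proof. by case=> fD _; apply: (addrI (f 0)); rewrite -fD !addr0. Qed.

Lemma mactN (m : M) (a : R) : mact (- m) a = - mact m a.
Proof. by apply: (addrI (mact m a)); rewrite -mactDl !subrr mact0r. Qed.

Lemma endo_hom_subgroup g : subgroup (endo_hom g).
Proof.
split=> [|f f' [[fD fA] fh] [[f'D f'A] f'h]].
  split; first by split=> x y; rewrite ?mact0r ?addr0.
  by move=> h x _; have [] := ohom_subgroup (gmul g h) (@mhom_subgroup _ _ M).
split; first split=> x y.
- by rewrite !fctE fD f'D opprD addrACA.
- by rewrite !fctE fA f'A mactDl mactN.
move=> h x hx.
by apply: (ohom_subgroup (gmul g h) (@mhom_subgroup _ _ M)).2; [apply: fh|apply: f'h].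
Qed.

Definition endo_family : subgroup_family G (M -> M) :=
  SubgroupFamily endo_hom_subgroup.

Lemma endo_eq0 (f : M -> M) : is_endo f ->
  (forall h x, mhom h x -> f x = 0) -> f = 0.
Proof.
move=> ef f0; apply/funext => x; elim/mhom_ind: x => [|x y hx hy|h x hx].
- by rewrite endo0.
- by rewrite ef.1 hx hy addr0.
- exact: f0 hx.
Qed.

Lemma endo_family_independent : independent endo_family.
Proof.
have [sgM _ indM] := mhom_direct M.
move=> s f us Ff f0 g gs; have [ef _] := Ff g.
apply: endo_eq0 => // h x hx.
apply: (ohom_independent (phi := fun g' => gmul g' h) sgM indM _
         (s := s) (f := fun g' => f g' x)) => //.
- by move=> i i' j; apply: gmul_injr.
- by move=> g'; apply: (Ff g').2.
- by have := congr1 (@^~ x) (fct_sumE s xpredT f); rewrite f0 /= => <-.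
Qed.

Lemma sumset_is_endo f : sumset endo_family f -> is_endo f.
Proof.
elim/sumset_ind => [|f1 f2 [f1D f1A] [f2D f2A]|g {}f []//].
  by split=> x y; rewrite ?mact0r ?addr0.
by split=> x y; rewrite !fctE ?f1D ?f2D ?f1A ?f2A ?mactDl// addrACA.
Qed.

Lemma endo_hom_comp (g h : G) f f' : endo_hom g f -> endo_hom h f' ->
  ohom endo_hom (gmul g h) (f \o f').
Proof.
move=> [ef fh] [ef' f'h].
have eff' : is_endo (f \o f').
  by split=> x y; rewrite /= ?ef'.1 ?ef.1 ?ef'.2 ?ef.2.
have ff'h k x : mhom k x ->
    ohom (@mhom _ _ M) (obind (fun gh => gmul gh k) (gmul g h)) (f (f' x)).
  move=> /f'h; rewrite -gmulA; case: (gmul h k) => [hk|] /=; first exact: fh.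
  by move=> ->; rewrite endo0.
case: (gmul g h) ff'h => [gh|] //= ff'h.
exact: endo_eq0.
Qed.

Lemma endo_compD (f f1 f2 : M -> M) :
  is_endo f -> f \o (f1 + f2) = (f \o f1) + (f \o f2).
Proof. by case=> fD _; apply/funext => x; exact: fD. Qed.

Lemma endo_comp_closed (f f' : M -> M) : sumset endo_family f -> sumset endo_family f' ->
  sumset endo_family (f \o f').
Proof.
have sg := sumset_subgroup (@sgfamP _ _ endo_family).
move=> hf hf'; elim/sumset_ind: hf => [|f1 f2 h1 h2|g {}f fg].
- exact: (subgroup0 sg).
- exact: (subgroupD sg h1 h2).
have ef : is_endo f by case: fg.
elim/sumset_ind: hf' => [|f1 f2 h1 h2|h {}f' fh].
- have -> : f \o (0 : M -> M) = 0 by apply/funext => x /=; rewrite (endo0 ef).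
  exact: (subgroup0 sg).
- by rewrite (endo_compD f1 f2 ef); exact: (subgroupD sg h1 h2).
have := endo_hom_comp fg fh; case: (gmul g h) => [gh|] /=.
  exact: (sumset_in (@sgfamP _ _ endo_family)).
by move=> ->; apply: subgroup0.
Qed.

Local Notation sort := (sumtype endo_family).

Definition END_mul (f f' : sort) : sort :=
  Sumtype (asboolT (endo_comp_closed (sumtype_sumset f) (sumtype_sumset f'))).

Lemma END_mulA : associative END_mul.
Proof. by move=> f1 f2 f3; apply: val_inj. Qed.
Lemma END_mulDl : left_distributive END_mul +%R.
Proof. by move=> f1 f2 f3; apply: val_inj. Qed.
Lemma END_mulDr : right_distributive END_mul +%R.
Proof.
move=> f1 f2 f3; apply: val_inj; apply/funext => x /=.
by rewrite fctE (sumset_is_endo (sumtype_sumset f1)).1.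
Qed.

Lemma END_hom_mul (g h : G) (f f' : sort) :
  sumtype_hom g f -> sumtype_hom h f' ->
  ohom (sumtype_hom (F := endo_family)) (gmul g h) (END_mul f f').
Proof.
move=> fg fh; have := endo_hom_comp fg fh.
case: (gmul g h) => [gh|] //= E; exact: val_inj.
Qed.

(* The projection M -> M(e).                                                  *)
Definition endo_one (e : gob G) : M -> M :=
  dproj [set h : G | gcod h = e] (@mhom _ _ M).

Lemma endo_one_id (h : G) x : mhom h x -> endo_one (gcod h) x = x.
Proof. by move=> hx; apply: (dproj_id (i := h)) => //; apply: mhom_direct. Qed.

Lemma endo_one_0 e (h : G) x : mhom h x -> gcod h <> e -> endo_one e x = 0.
Proof. by move=> hx ne; apply: (dproj_0 (i := h)) => //; apply: mhom_direct. Qed.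

Lemma endo_oneD e x y : endo_one e (x + y) = endo_one e x + endo_one e y.
Proof. exact/dprojD/mhom_direct. Qed.

Lemma endo_one0 e : endo_one e 0 = 0.
Proof. by apply: (addrI (endo_one e 0)); rewrite -endo_oneD !addr0. Qed.

Lemma endo_one_act e x (a : R) : endo_one e (mact x a) = mact (endo_one e x) a.
Proof.
elim/rhom_ind: a => [|a b ha hb|k a ka].
- by rewrite !mactr0 endo_one0.
- by rewrite !mactDr endo_oneD ha hb.
elim/mhom_ind: x => [|x y hx hy|h x hx].
- by rewrite mact0r endo_one0 mact0r.
- by rewrite endo_oneD !mactDl endo_oneD hx hy.
have := mhom_act hx ka; case E: (gmul h k) => [hk|] /=; last first.
  move=> xa0; rewrite xa0 endo_one0.
  have [<-|ne] := eqVneq (gcod h) e; first by rewrite endo_one_id.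
  by rewrite (endo_one_0 hx (elimN eqP ne)) mact0r.
move=> hxa; have cE := gcod_mul E.
have [<-|ne] := eqVneq (gcod h) e.
  by rewrite (endo_one_id hx) -cE (endo_one_id hxa).
rewrite (endo_one_0 hx (elimN eqP ne)) mact0r (endo_one_0 hxa)// cE.
exact: (elimN eqP ne).
Qed.

Lemma endo_one_hom e : endo_hom (gid e) (endo_one e).
Proof.
split; first by split=> [x y|x a]; [exact: endo_oneD|exact: endo_one_act].
move=> h x hx; have [<-|ne] := eqVneq (gcod h) e.
  by rewrite endo_one_id// gmul1l.
rewrite (endo_one_0 hx (elimN eqP ne)).
by have [] := ohom_subgroup (gmul (gid e) h) (@mhom_subgroup _ _ M).
Qed.

Definition END_one (e : gob G) : sort :=
  Sumtype (sumtype_in (F := endo_family) (endo_one_hom e)).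

Lemma END_one_hom e : sumtype_hom (gid e) (END_one e).
Proof. exact: endo_one_hom. Qed.

Lemma END_one_mull (g : G) f : sumtype_hom g f -> END_mul (END_one (gcod g)) f = f.
Proof.
move=> [ef fh]; apply: val_inj; apply/funext => x.
change (endo_one (gcod g) (val f x) = val f x).
elim/mhom_ind: x => [|x y hx hy|h x hx].
- by rewrite (endo0 ef) endo_one0.
- by rewrite ef.1 endo_oneD hx hy.
have := fh _ _ hx; case E: (gmul g h) => [gh|] /=.
  by move=> hfx; rewrite -(gcod_mul E) endo_one_id.
by move=> ->; rewrite endo_one0.
Qed.

Lemma END_one_mulr (g : G) f : sumtype_hom g f -> END_mul f (END_one (gdom g)) = f.
Proof.
move=> [ef fh]; apply: val_inj; apply/funext => x.
change (val f (endo_one (gdom g) x) = val f x).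
elim/mhom_ind: x => [|x y hx hy|h x hx].
- by rewrite endo_one0.
- by rewrite endo_oneD !ef.1 hx hy.
have [E|/eqP ne] := eqVneq (gcod h) (gdom g); first by rewrite -E endo_one_id.
rewrite (endo_one_0 hx ne) (endo0 ef); have := fh _ _ hx.
by rewrite gmul_None; [move=> -> | move/esym].
Qed.

Definition END : grRing G :=
  GrRing END_mulA END_mulDl END_mulDr
    (sumtype_direct endo_family_independent) END_hom_mul
    END_one_hom END_one_mull END_one_mulr.

End End.

Section Notions.
Variable G : groupoid.

Section Rings.
Variable R : grRing G.

Definition ring_support0 : set (gob G) := [set e | rone R e <> 0].

Definition gr_ideal (I : set R) : Prop :=
  [/\ subgroup I,
      forall a x, I x -> I (rmul a x) /\ I (rmul x a) &
      forall x, I x -> sumset (fun g : G => I `&` rhom g) x].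

Definition ideal_mul (I J : set R) : set R :=
  [set x | exists s : seq (R * R),
     (forall p, p \in s -> I p.1 /\ J p.2) /\ x = \sum_(p <- s) rmul p.1 p.2].

Definition gr_division_ring : Prop :=
  (exists x : R, x <> 0) /\
  forall (g : G) (a : R), rhom g a -> a <> 0 ->
    exists b : R, [/\ rhom (ginv g) b,
      rmul a b = rone R (gcod g) & rmul b a = rone R (gdom g)].

Definition gr_simple_ring : Prop :=
  (exists x : R, x <> 0) /\
  forall I : set R, gr_ideal I -> I = [set 0] \/ I = setT.

Definition gr_prime_ring : Prop :=
  forall I J : set R, gr_ideal I -> gr_ideal J ->
    I <> [set 0] -> J <> [set 0] -> ideal_mul I J <> [set 0].

(* 1_e R 1_f <> 0                                                             *)
Definition gr_primality (e f : gob G) : Prop :=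
  exists a : R, rmul (rmul (rone R e) a) (rone R f) <> 0.

End Rings.

Section Modules.
Variable R : grRing G.
Implicit Types M N : grModule R.

Definition gr_submodule M (N : set M) : Prop :=
  [/\ subgroup N,
      forall x (a : R), N x -> N (mact x a) &
      forall x, N x -> sumset (fun g : G => N `&` mhom g) x].

Definition gr_simple M : Prop :=
  (exists x : M, x <> 0) /\
  forall N : set M, gr_submodule N -> N = [set 0] \/ N = setT.

(* M(e)                                                                       *)
Definition component M (e : gob G) : grModule R := shift M (gid e).

Definition module_support0 M : set (gob G) :=
  [set e | exists x : component M e, x <> 0].

Definition simple0 M : Prop :=
  forall e, module_support0 M e -> gr_simple (component M e).

Definition gr_iso M N : Prop :=
  exists f : M -> N,
    [/\ bijective f,
        forall x y, f (x + y) = f x + f y,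
        forall x (a : R), f (mact x a) = mact (f x) a &
        forall (g : G) x, mhom g x -> mhom g (f x)].

Definition isoshift M N : Prop := exists g : G, gr_iso M (shift N g).

Definition isoshift_class M : grModule R -> Prop :=
  eqclass gr_simple isoshift M.

End Modules.
End Notions.

(* Main.v *)
Require Import Defs.
From mathcomp Require Import all_boot all_algebra.
From mathcomp Require Import mathcomp_extra boolp classical_sets functions.

Set Implicit Arguments.
Unset Strict Implicit.
Unset Printing Implicit Defensive.

Import GRing.Theory.
Local Open Scope ring_scope.

(** The theorem is a graded Schur lemma followed by ring theory.

    A nonzero homomorphism of degree [g] between gr-simple graded modules
    [M] and [N] has a graded kernel and a graded image, so it is bijective; as
    its degree is a single element of a groupoid, its inverse has degree
    [ginv g] ([gr_schur]). Consequently [M] and [N] are isoshifts of each other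
    exactly when some nonzero homomorphism of some degree goes from [M] to [N]
    ([isoshift_homP]): the shift only renames degrees. In this form, symmetry
    and transitivity of isoshift become inversion and composition.

    An endomorphism of [S] of degree [g : e -> f] kills every [S(e')] with
    [e' <> e] and takes its values in [S(f)], so it amounts to a homomorphism
    [S(e) -> S(f)] of degree [g] ([endo_hom_component],
    [component_endo_hom]). Schur's lemma for the gr-simple modules [S(e)] then
    says both that nonzero homogeneous elements of [END S] are invertible,
    which is (1), and that [1_f (END S) 1_e <> 0] exactly when [S(e)] and [S(f)]
    are isoshifts of each other, which is (2) after exchanging [e] and [f]
    by symmetry. Part (3) follows since primality and isoshift are equivalence
    relations.

    Part (4) is about graded rings: a gr-simple ring is gr-prime; in a
    gr-prime ring the product of the ideals generated by [1_e] and [1_f] is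
    nonzero, which forces [e ~ f]; and in a gr-division ring whose objects are
    all related, a nonzero graded ideal contains an invertible homogeneous
    element, hence one nonzero [1_e], hence all of them. *)

(** * Primality of objects in graded rings *)

Section PrimalityRelation.
Variables (G : groupoid) (R : grRing G).
Implicit Types (e f : gob G) (a b x y : R).

Lemma rmul_ne_one (g : G) a e : rhom g a -> gcod g <> e -> rmul (rone R e) a = 0.
Proof.
move=> ga ne; have := rhom_mul (rone_hom R e) ga.
by rewrite gmul_None ?gdom_id // => /esym.
Qed.

Lemma rone_idem e : rmul (rone R e) (rone R e) = rone R e.
Proof. by have := rone_mull (rone_hom R e); rewrite gcod_id. Qed.

(** [1_e a 1_f] is the sum of the components of [a] whose degree goes from [f]
    to [e], so one of these is nonzero when [1_e a 1_f] is. *)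
Lemma gr_primality_homP e f : gr_primality R e f <->
  exists (g : G) a, [/\ gdom g = f, gcod g = e, rhom g a & a <> 0].
Proof.
split=> [[a]|[g [a [<- <- ga nz]]]]; last first.
  by exists a; rewrite (rone_mull ga) (rone_mulr ga).
apply: contra_notP => H; elim/rhom_ind: a => [|x y hx hy|g x gx].
- by rewrite rmulr0 rmul0r.
- by rewrite rmulDr rmulDl hx hy addr0.
have [ge|ne] := pselect (gcod g = e); last first.
  by rewrite (rmul_ne_one gx ne) rmul0r.
have [gf|nf] := pselect (gdom g = f); last first.
  by rewrite -rmulA (rmul_one_ne gx nf) rmulr0.
have [->|nz] := pselect (x = 0); first by rewrite rmulr0 rmul0r.
by case: H; exists g, x.
Qed.

(** Both ideals are the whole ring, so their product contains every
    [1_e = 1_e 1_e]; these are not all zero, for they generate the ring. *)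
Lemma gr_simple_ring_prime : gr_simple_ring R -> gr_prime_ring R.
Proof.
case=> [[x nx] simR] I J idI idJ I0 J0.
have [//|->] := simR I idI; have [//|->] := simR J idJ.
have [e ne] : exists e, rone R e <> 0.
  apply: contra_notP nx => H; elim/rhom_ind: x => [|x y -> ->|g a ga] //.
    by rewrite addr0.
  rewrite -(rone_mull ga); have [->|nz] := pselect (rone R (gcod g) = 0).
    by rewrite rmul0r.
  by case: H; exists (gcod g).
move=> IJ0; apply: ne; suff: [set 0]%classic (rone R e) by [].
rewrite -IJ0; exists [:: (rone R e, rone R e)]; split=> //.
by rewrite big_seq1 rone_idem.
Qed.

(** The ideal R 1_e R, as the sum over [x] of the subgroups x 1_e R. *)
Definition one_ideal e : set R :=
  sumset (fun x : R => [set rmul (rmul x (rone R e)) y | y in setT]%classic).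

Lemma one_ideal_subgroup e : subgroup (one_ideal e).
Proof.
apply: sumset_subgroup => x; split; first by exists 0; rewrite ?rmulr0.
move=> _ _ [y _ <-] [z _ <-]; exists (y - z) => //.
apply/eqP; rewrite eq_sym subr_eq -rmulDr subrK //.
Qed.

Lemma one_ideal_mem e x y : one_ideal e (rmul (rmul x (rone R e)) y).
Proof.
exists [:: x], (fun z => if z == x then rmul (rmul x (rone R e)) y else 0).
split=> [z|]; last by rewrite big_seq1 eqxx.
by case: eqP => [->|_]; [exists y | exists 0; rewrite ?rmulr0].
Qed.

Lemma one_ideal_one e : one_ideal e (rone R e).
Proof. by rewrite -{1}rone_idem -{1}rone_idem; apply: one_ideal_mem. Qed.

(** R 1_e R is graded because it is spanned by the products [x 1_e y] with [x]
    and [y] homogeneous. *)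
Lemma one_ideal_gr_ideal e : gr_ideal (one_ideal e).
Proof.
have sgI := one_ideal_subgroup e; have [sgR _ _] := rhom_direct R.
have sgF g : subgroup (one_ideal e `&` rhom (g : G))%classic.
  split; first by split; apply: subgroup0.
  by move=> x y [Ix hx] [Iy hy]; split; [apply: sgI.2 | apply: (sgR g).2].
have sgS := sumset_subgroup sgF.
split=> // [a x|x].
  elim/sumset_ind => [|x1 x2 [h1 h1'] [h2 h2']|z _ [y _ <-]].
  - by rewrite rmulr0 rmul0r; split; apply: subgroup0.
  - by rewrite rmulDr rmulDl; split; apply: (subgroupD sgI).
  by split; [rewrite !rmulA | rewrite -rmulA]; apply: one_ideal_mem.
elim/sumset_ind => [|x1 x2 h1 h2|z _ [y _ <-]].
- exact: subgroup0.
- exact: subgroupD.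
elim/rhom_ind: z => [|z1 z2 h1 h2|g z gz].
- by rewrite !rmul0r; apply: subgroup0.
- by rewrite !rmulDl; apply: subgroupD.
have [ge|ne] := pselect (gdom g = e); last first.
  by rewrite (rmul_one_ne gz ne) rmul0r; apply: subgroup0.
elim/rhom_ind: y => [|y1 y2 h1 h2|h y hy].
- by rewrite !rmulr0; apply: subgroup0.
- by rewrite !rmulDr; apply: subgroupD.
have Im := one_ideal_mem e z y.
subst e; rewrite (rone_mulr gz) in Im *; have := rhom_mul gz hy.
case: (gmul g h) => [gh|] /= zy; last by rewrite zy; apply: subgroup0.
exact: (sumset_in sgF (i := gh)).
Qed.

(** Otherwise 1_e R 1_f = 0, and then (R 1_e R)(R 1_f R) = 0, although both
    factors are nonzero. *)
Lemma gr_prime_ring_primality : gr_prime_ring R ->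
  forall e f, ring_support0 R e -> ring_support0 R f -> gr_primality R e f.
Proof.
move=> prR e f ne nf.
have nz (e' : gob G) : ring_support0 R e' -> one_ideal e' <> [set 0]%classic.
  move=> ne' I0; apply: ne'; suff: [set 0]%classic (rone R e') by [].
  by rewrite -I0; apply: one_ideal_one.
have := prR _ _ (one_ideal_gr_ideal e) (one_ideal_gr_ideal f) (nz _ ne) (nz _ nf).
apply: contra_notP => H.
have H0 a : rmul (rmul (rone R e) a) (rone R f) = 0.
  by apply: contrapT => Ha; apply: H; exists a.
have I0 x y : one_ideal e x -> one_ideal f y -> rmul x y = 0.
  elim/sumset_ind => [|x1 x2 h1 h2|x1 _ [x2 _ <-]] Iy.
  - by rewrite rmul0r.
  - by rewrite rmulDl h1 // h2 // addr0.
  elim/sumset_ind: Iy => [|y1 y2 h1 h2|y1 _ [y2 _ <-]].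
  - by rewrite rmulr0.
  - by rewrite rmulDr h1 h2 addr0.
  have := H0 (rmul x2 y1); rewrite !rmulA => /(congr1 (fun z => rmul (rmul x1 z) y2)).
  by rewrite rmulr0 rmul0r !rmulA.
apply/seteqP; split=> [_ [s [sP ->]]|_ ->] /=.
  by rewrite big_seq big1 // => p /sP[]; apply: I0.
by exists [::]; rewrite big_nil; split.
Qed.

Section Division.
Hypothesis divR : gr_division_ring R.

Lemma gr_division_mul_neq0 (g h : G) a b : gdom g = gcod h ->
  rhom g a -> rhom h b -> a <> 0 -> b <> 0 -> rmul a b <> 0.
Proof.
move=> gh ga hb na nb; have [c [_ _ ca]] := divR.2 _ _ ga na.
move=> /(congr1 (rmul c)); rewrite rmulA ca rmulr0 gh (rone_mull hb).
exact: nb.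
Qed.

(** Inverses of homogeneous elements give symmetry, and their nonzero products
    give transitivity. *)
Lemma gr_division_primality_equiv :
  equiv_on (ring_support0 R) (@gr_primality G R).
Proof.
split=> [e ne|e f _ _|e f k _ _ _].
- by exists (rone R e); rewrite !rone_idem.
- move=> /gr_primality_homP[g [a [<- <- ga na]]].
  have [b [gb ab ba]] := divR.2 _ _ ga na.
  exists b => /(congr1 (rmul a)).
  rewrite rmulr0 !rmulA (rone_mulr ga) ab rone_idem => one0.
  by apply: na; rewrite -(rone_mull ga) one0 rmul0r.
move=> /gr_primality_homP[g [a [<- <- ga na]]].
move=> /gr_primality_homP[h [b [<- hg hb nb]]].
exists (rmul a b); rewrite !rmulA (rone_mull ga) -rmulA (rone_mulr hb).
by apply: gr_division_mul_neq0 ga hb na nb; rewrite hg.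
Qed.

(** A nonzero graded ideal contains an invertible [a], hence 1_c for the
    codomain [c] of its degree. For any other object [e] in the support,
    a nonzero element of 1_e R 1_c carries 1_c to 1_e inside the ideal. *)
Lemma gr_division_primality_simple :
  (forall e f, ring_support0 R e -> ring_support0 R f -> gr_primality R e f) ->
  gr_simple_ring R.
Proof.
move=> prim; split; first exact: divR.1.
move=> I [sgI IM grI]; have [I0|] := pselect (I = [set 0]%classic); first by left.
move=> nI; right.
have [g [a [Ia ga na]]] : exists (g : G) a, [/\ I a, rhom g a & a <> 0].
  apply: contra_notP nI => H; apply/seteqP; split=> [x /grI|x ->] /=.
    elim/sumset_ind => [|x1 x2 -> ->|g a [Ia ga]]; rewrite ?addr0 //.
    by apply: contrapT => na; apply: H; exists g, a.
  exact: subgroup0.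
have [b [_ ab _]] := divR.2 _ _ ga na.
have I1 : I (rone R (gcod g)) by rewrite -ab; apply: (IM _ _ Ia).2.
have n1 : ring_support0 R (gcod g).
  by move=> one0; apply: na; rewrite -(rone_mull ga) one0 rmul0r.
have Ione e : I (rone R e).
  have [->|ne] := pselect (rone R e = 0); first exact: subgroup0.
  have /gr_primality_homP[h [c [hg <- hc nc]]] := prim _ _ ne n1.
  have [d [_ <- _]] := divR.2 _ _ hc nc.
  rewrite -(rone_mulr hc) hg; apply: (IM _ _ _).2.
  exact: (IM _ _ I1).1.
apply/seteqP; split=> // x _; elim/rhom_ind: x => [|x y Ix Iy|h x hx].
- exact: subgroup0.
- exact: subgroupD.
by rewrite -(rone_mull hx); apply: (IM _ _ (Ione _)).2.
Qed.

End Division.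
End PrimalityRelation.

(** * Homomorphisms of a given degree and Schur's lemma *)

Lemma gmulK (G : groupoid) (g h k : G) :
  gmul g h = Some k -> gmul (ginv g) k = Some h.
Proof.
move=> E; have := gmulA (ginv g) g h; rewrite E gmulVl /= => ->.
have -> : gdom g = gcod h by apply/gmul_defined; rewrite E.
exact: gmul1l.
Qed.

Section Homomorphisms.
Variables (G : groupoid) (R : grRing G).
Implicit Types M N P : grModule R.

Definition hom_of_degree M N (g : G) (f : M -> N) : Prop :=
  [/\ forall x y, f (x + y) = f x + f y,
      forall x (a : R), f (mact x a) = mact (f x) a &
      forall (h : G) x, mhom h x -> ohom (@mhom _ _ N) (gmul g h) (f x)].

Lemma hom_of_degree_comp M N P (g h k : G) (f : N -> P) (f' : M -> N) :
  gmul g h = Some k -> hom_of_degree g f -> hom_of_degree h f' ->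
  hom_of_degree k (f \o f').
Proof.
move=> gh [fD fA fh] [f'D f'A f'h].
split=> [x y|x a|l x lx] /=; rewrite ?f'D ?f'A //.
have := gmulA g h l; rewrite gh /= => <-.
have := f'h _ _ lx; case: (gmul h l) => [hl|] /=; first exact: fh.
by move=> ->; apply: (addrI (f 0)); rewrite -fD !addr0.
Qed.

Section OneHomomorphism.
Variables (M N : grModule R) (g : G) (f : M -> N).
Hypothesis hf : hom_of_degree g f.

Lemma hom0 : f 0 = 0.
Proof. by case: hf => fD _ _; apply: (addrI (f 0)); rewrite -fD !addr0. Qed.

Lemma homN x : f (- x) = - f x.
Proof.
by case: hf => fD _ _; apply: (addrI (f x)); rewrite -fD !subrr hom0.
Qed.

Lemma homB x y : f (x - y) = f x - f y.
Proof. by case: hf => fD _ _; rewrite fD homN. Qed.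

Lemma hom_sum (I : Type) (s : seq I) (F : I -> M) :
  f (\sum_(i <- s) F i) = \sum_(i <- s) f (F i).
Proof.
elim: s => [|i s IHs]; first by rewrite !big_nil hom0.
by case: hf => fD _ _; rewrite !big_cons fD IHs.
Qed.

(** Left translation by [g] is injective on degrees, so the images of the
    components of [x] lie in distinct degrees, and vanish when their sum does. *)
Lemma ker_gr_submodule : gr_submodule [set x | f x = 0]%classic.
Proof.
have [fD fA fh] := hf; split=> [|x a /= fx0|x /= fx0].
- by split=> /= [|x y fx fy]; rewrite ?hom0 // homB fx fy subr0.
- by rewrite fA fx0 mact0r.
have [sgM /(_ x) spM _] := mhom_direct M; have [sgN _ indN] := mhom_direct N.
have [s [F [us Fh xE]]] := sumset_uniq sgM spM.
have F0 i : i \in s -> f (F i) = 0.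
  apply: (ohom_independent (phi := gmul g) sgN indN
    (fun i i' j => @gmul_injl _ g i i' j) us (f := f \o F)) => /=.
    by move=> j; apply: fh.
  by rewrite -hom_sum -xE.
exists s, (fun i => if i \in s then F i else 0); split.
  move=> i; case: ifP => [/F0 fF0|_]; split=> //=; rewrite ?hom0 //.
  exact: subgroup0.
by rewrite xE big_seq [RHS]big_seq; apply: eq_bigr => i ->.
Qed.

Lemma range_gr_submodule : gr_submodule (range f).
Proof.
have [fD fA fh] := hf; have [sgN _ _] := mhom_direct N.
have sgI : subgroup (range f).
  split; first by exists 0; rewrite ?hom0.
  by move=> _ _ [x _ <-] [y _ <-]; exists (x - y); rewrite ?homB.
split=> [|_ a [x _ <-]|_ [x _ <-]] //; first by exists (mact x a).
have sgF h : subgroup (range f `&` mhom (h : G))%classic.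
  split; first by split; apply: subgroup0.
  by move=> y z [Iy hy] [Iz hz]; split; [apply: sgI.2 | apply: (sgN h).2].
have sgS := sumset_subgroup sgF.
elim/mhom_ind: x => [|x y hx hy|h x hx].
- by rewrite hom0; apply: subgroup0.
- by rewrite fD; apply: subgroupD.
have := fh _ _ hx; case: (gmul g h) => [gh|] /= ghx.
  by apply: (sumset_in sgF (i := gh)); split=> //; exists x.
by rewrite ghx; apply: subgroup0.
Qed.

(** An injective homomorphism of degree [g] reflects degrees, which makes the
    inverse of a bijective one homogeneous. *)
Lemma hom_inj_degree : injective f -> forall (h : G) x, mhom h (f x) ->
  ohom (@mhom _ _ M) (gmul (ginv g) h) x.
Proof.
have [fD _ fh] := hf.
move=> injf h x fx; have dM := mhom_direct M; have [sgM _ _] := dM.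
have [sgN _ indN] := mhom_direct N.
pose P := [set k : G | gmul g k = Some h]%classic.
(* [P] has at most one element, the solution [k] of g k = h. The component [y]
   of [x] there has the same image as [x], since f x - f y has its degrees
   both in {h} and outside it. *)
have [Px nPx] := dproj_spec P x dM; move: Px nPx; set y := dproj P _ x => Py nPxy.
have sgh := ohom_subgroup (gmul (ginv g) h) sgM.
suff -> : x = y.
  elim/sumset_ind: Py => [|y1 y2|k z []].
  - exact: subgroup0.
  - exact: subgroupD.
  - by move=> ->; apply: subgroup0.
  by move=> [/gmulK ->].
apply: injf; apply/eqP; rewrite -subr_eq0; apply/eqP.
apply: (restrict_capC (P := [set h]%classic) sgN indN).
  apply: (restrict_sumset_subgroup [set h]%classic sgN).2.
    by apply: (sumset_in (i := h)); [exact: restrict_subgroup | by right].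
  elim/sumset_ind: Py => [|y1 y2 h1 h2|k z [->|[Pk hz]]]; rewrite ?fD ?hom0.
  - exact: (subgroup0 (restrict_sumset_subgroup _ sgN)).
  - exact: (subgroupD (restrict_sumset_subgroup _ sgN) h1 h2).
  - exact: (subgroup0 (restrict_sumset_subgroup _ sgN)).
  apply: (sumset_in (i := h)); [exact: restrict_subgroup | right; split=> //].
  by have := fh _ _ hz; rewrite Pk.
rewrite -homB; elim/sumset_ind: nPxy => [|y1 y2 h1 h2|k z [->|[Pk hz]]];
  rewrite ?fD ?hom0.
- exact: (subgroup0 (restrict_sumset_subgroup _ sgN)).
- exact: (subgroupD (restrict_sumset_subgroup _ sgN) h1 h2).
- exact: (subgroup0 (restrict_sumset_subgroup _ sgN)).
have := fh _ _ hz; case E: (gmul g k) => [gk|] /= hfz; last first.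
  by rewrite hfz; exact: (subgroup0 (restrict_sumset_subgroup _ sgN)).
apply: (sumset_in (i := gk)); [exact: restrict_subgroup | right; split=> //].
by move=> gkh; apply: Pk; rewrite /P /mkset E gkh.
Qed.

(** The kernel is not everything and the image is not zero, so simplicity of
    source and target makes [f] bijective. *)
Lemma gr_schur : gr_simple M -> gr_simple N -> (exists x, f x <> 0) ->
  exists f' : N -> M,
    [/\ hom_of_degree (ginv g) f', cancel f f' & cancel f' f].
Proof.
have [fD fA fh] := hf; move=> [_ simM] [_ simN] [x0 nx0].
have injf : injective f.
  have [kE|kE] := simM _ ker_gr_submodule; last first.
    by case: nx0; have : [set: M]%classic x0 by []; rewrite -kE.
  move=> x y fxy; apply/eqP; rewrite -subr_eq0; apply/eqP.
  suff: [set 0]%classic (x - y) by [].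
  by rewrite -kE /= homB fxy subrr.
have rT : range f = setT.
  have [rE|//] := simN _ range_gr_submodule.
  by case: nx0; have : range f (f x0) by [exists x0]; rewrite rE.
have surf y : exists x, f x == y.
  have : [set: N]%classic y by [].
  by rewrite -rT => -[x _ <-]; exists x.
pose f' y := xchoose (surf y).
have fK : cancel f' f by move=> y; apply/eqP/(xchooseP (surf y)).
exists f'; split=> //; last exact: inj_can_sym fK injf.
split=> [x y|x a|h y hy].
- by apply: injf; rewrite fD !fK.
- by apply: injf; rewrite fA !fK.
by apply: hom_inj_degree => //; rewrite fK.
Qed.

End OneHomomorphism.

(** A homomorphism of degree [g] to [N] takes its values in [shift N g] and
    preserves degrees as a map to it; by Schur's lemma it is bijective as soon
    as it is nonzero. *)
Lemma isoshift_homP M N : gr_simple M -> gr_simple N ->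
  (isoshift M N <->
   exists (g : G) (f : M -> N), hom_of_degree g f /\ exists x, f x <> 0).
Proof.
move=> simM simN; split=> [[g [f [[f' fK _] fD fA fh]]]|[g [f [hf nf]]]].
  have hf : hom_of_degree g (fun x => val (f x)).
    by split=> [x y|x a|h x hx]; rewrite ?fD ?fA //; apply: fh.
  exists g, (fun x => val (f x)); split=> //.
  have [[x nx] _] := simM; exists x => fx0; apply: nx.
  apply: (can_inj fK); apply: val_inj.
  by rewrite fx0 (hom0 hf).
have [f' [_ fK f'K]] := gr_schur hf simM simN nf; have [fD fA fh] := hf.
have mem x : sumset (shift_family N g) (f x).
  have sg := sumset_subgroup (@sgfamP _ _ (shift_family N g)).
  elim/mhom_ind: x => [|x y hx hy|h x hx].
  - by rewrite (hom0 hf); apply: subgroup0.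
  - by rewrite fD; apply: subgroupD.
  by apply: (sumset_in (@sgfamP _ _ (shift_family N g)) (i := h)); apply: fh.
exists g, (fun x => Sumtype (asboolT (mem x)) : shift N g); split.
- exists (fun u => f' (val u)); [exact: fK | move=> u].
  by apply: val_inj => /=; apply: f'K.
- by move=> x y; apply: val_inj; rewrite /= fD.
- by move=> x a; apply: val_inj; rewrite /= fA.
by move=> h x hx; apply: fh.
Qed.

Lemma isoshift_sym M N : gr_simple M -> gr_simple N ->
  isoshift M N -> isoshift N M.
Proof.
move=> simM simN /(isoshift_homP simM simN)[g [f [hf nf]]].
have [f' [hf' fK f'K]] := gr_schur hf simM simN nf.
apply/(isoshift_homP simN simM); exists (ginv g), f'; split=> //.
have [[x nx] _] := simM; exists (f x).
by rewrite fK.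
Qed.

Lemma isoshift_trans M N P : gr_simple M -> gr_simple N -> gr_simple P ->
  isoshift M N -> isoshift N P -> isoshift M P.
Proof.
move=> simM simN simP /(isoshift_homP simM simN)[g [f [hf nf]]].
move=> /(isoshift_homP simN simP)[g' [f' [hf' nf']]].
have [l [_ fK _]] := gr_schur hf simM simN nf.
have [l' [_ fK' _]] := gr_schur hf' simN simP nf'.
have nc x : x <> 0 -> f' (f x) <> 0.
  move=> nx f0; apply: nx; apply: (can_inj fK); apply: (can_inj fK').
  by rewrite f0 (hom0 hf) (hom0 hf').
have [[x nx] _] := simM.
(* If the product of the degrees is undefined, the composite is zero, whereas it
   is injective on the nonzero module M. *)
case E: (gmul g' g) => [k|].
  apply/(isoshift_homP simM simP); exists k, (f' \o f).
  by split; [exact: hom_of_degree_comp E hf' hf | exists x; apply: nc].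
case: (nc _ nx); have [f'D _ f'h] := hf'; have [fD _ fh] := hf.
elim/mhom_ind: x {nx} => [|x y hx hy|h x hx].
- by rewrite (hom0 hf) (hom0 hf').
- by rewrite fD f'D hx hy addr0.
have := fh _ _ hx; have := gmulA g' g h; rewrite E /=.
case: (gmul g h) => [gh|] /= gE; last by move=> ->; rewrite (hom0 hf').
by move=> /f'h; rewrite gE.
Qed.

Lemma isoshift_class_eq M N : gr_simple M -> gr_simple N -> isoshift M N ->
  isoshift_class M = isoshift_class N.
Proof.
move=> simM simN MN; apply/funext => P; apply/propext.
split=> -[simP iP]; split=> //; last exact: isoshift_trans MN iP.
exact: isoshift_trans simN simM simP (isoshift_sym simM simN MN) iP.
Qed.

End Homomorphisms.

(** * Endomorphisms as homomorphisms between components *)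

Section Components.
Variables (G : groupoid) (R : grRing G) (S : grModule R).
Implicit Types (e f : gob G).

Lemma endo_one_cod (g : G) (a : S -> S) x :
  endo_hom g a -> endo_one (gcod g) (a x) = a x.
Proof.
move=> ga; pose u : END S := Sumtype (sumtype_in (F := endo_family S) ga).
have hu : rhom g u by [].
exact: (congr1 (fun v : END S => val v x) (rone_mull hu)).
Qed.

Lemma endo_one_dom (g : G) (a : S -> S) x :
  endo_hom g a -> a (endo_one (gdom g) x) = a x.
Proof.
move=> ga; pose u : END S := Sumtype (sumtype_in (F := endo_family S) ga).
have hu : rhom g u by [].
exact: (congr1 (fun v : END S => val v x) (rone_mulr hu)).
Qed.

Lemma endo_one_val e (u : component S e) : endo_one e (val u) = val u.
Proof.
elim/mhom_ind: u => [|u v hu hv|h u].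
- by rewrite raddf0 endo_one0.
- by rewrite raddfD endo_oneD hu hv.
change (ohom (@mhom _ _ S) (gmul (gid e) h) (val u) -> endo_one e (val u) = val u).
have [he|ne] := pselect (gcod h = e); last first.
  by rewrite gmul_None ?gdom_id => [->|/esym //]; rewrite endo_one0.
by subst e; rewrite gmul1l; apply: endo_one_id.
Qed.

Lemma mhom_val e (h : G) (u : component S e) : mhom h u -> mhom h (val u).
Proof.
change (ohom (@mhom _ _ S) (gmul (gid e) h) (val u) -> mhom h (val u)).
have [he|ne] := pselect (gcod h = e); first by subst e; rewrite gmul1l.
rewrite gmul_None ?gdom_id => [->|/esym //].
exact: subgroup0 (mhom_subgroup S h).
Qed.

Lemma endo_one_sumset e x : sumset (shift_family S (gid e)) (endo_one e x).
Proof.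
have sgF := @sgfamP _ _ (shift_family S (gid e)).
have sg := sumset_subgroup sgF.
elim/mhom_ind: x => [|x y hx hy|h x hx].
- by rewrite endo_one0; apply: subgroup0.
- by rewrite endo_oneD; apply: subgroupD.
by apply: (sumset_in sgF (i := h)); apply: (endo_one_hom S e).2.
Qed.

Definition comp_proj e (x : S) : component S e :=
  Sumtype (asboolT (endo_one_sumset e x)).

Lemma comp_projK e : cancel val (comp_proj e).
Proof. by move=> u; apply: val_inj; rewrite /= endo_one_val. Qed.

Lemma endo_hom_component (g : G) e f (a : S -> S) : endo_hom g a ->
  hom_of_degree g (fun u : component S e => comp_proj f (a (val u))).
Proof.
move=> [[aD aA] ah]; split=> [u v|u r|h u hu].
- by apply: val_inj; rewrite /= aD endo_oneD.
- by apply: val_inj; rewrite /= aA endo_one_act.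
have := ah _ _ (mhom_val hu); case: (gmul g h) => [gh|] /= ahu.
  exact: (endo_one_hom S f).2.
by apply: val_inj; rewrite /= ahu endo_one0.
Qed.

Lemma component_endo_hom (g : G) e f (p : component S e -> component S f) :
  hom_of_degree g p -> endo_hom g (fun x => val (p (comp_proj e x))).
Proof.
move=> [pD pA ph]; split; first split=> [x y|x r].
- have -> : comp_proj e (x + y) = comp_proj e x + comp_proj e y.
    by apply: val_inj; rewrite /= endo_oneD.
  by rewrite pD.
- have -> : comp_proj e (mact x r) = mact (comp_proj e x) r.
    by apply: val_inj; rewrite /= endo_one_act.
  by rewrite pA.
move=> h x hx.
have /ph : mhom h (comp_proj e x) by apply: (endo_one_hom S e).2.
by case: (gmul g h) => [gh|] /=; [apply: mhom_val | move=> ->].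
Qed.

Lemma END_neq0 (a : END S) : a <> 0 -> exists x, val a x <> 0.
Proof.
apply: contra_notP => H; apply: val_inj; apply/funext => x.
by apply: contrapT => nx; apply: H; exists x.
Qed.

Lemma module_support0P e (x : S) : endo_one e x <> 0 -> module_support0 S e.
Proof. by move=> nx; exists (comp_proj e x) => /(congr1 val). Qed.

Lemma END_support0 : ring_support0 (END S) = module_support0 S.
Proof.
apply/seteqP; split=> e /=.
  apply: contra_notP => H; apply: val_inj; apply/funext => x /=.
  apply: contrapT => nx; apply: H; exists (comp_proj e x).
  by move/(congr1 val).
case=> u nu /(congr1 (fun v : END S => val v (val u))) /=.
rewrite endo_one_val => u0; apply: nu; exact: val_inj.
Qed.

Hypothesis S_simple0 : simple0 S.

(** A nonzero endomorphism of degree g : e -> f restricts to a nonzero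
    homomorphism S(e) -> S(f); its inverse, extended by zero, is the inverse
    in [END S]. *)
Lemma END_division : (exists x : S, x <> 0) -> gr_division_ring (END S).
Proof.
move=> [x0 nx0]; split.
  apply: contra_notP nx0 => H; elim/mhom_ind: x0 => [|x y -> ->|h x hx] //.
    by rewrite addr0.
  rewrite -(endo_one_id hx); apply: contrapT => nx; apply: H.
  by exists (END_one S (gcod h)) => /(congr1 (fun v : END S => val v x)).
move=> g a; change (endo_hom g (val a) -> a <> 0 -> exists b : END S,
  [/\ endo_hom (ginv g) (val b), END_mul a b = END_one S (gcod g)
    & END_mul b a = END_one S (gdom g)]) => ga na.
have [x nx] := END_neq0 na.
have simd : gr_simple (component S (gdom g)).
  by apply/S_simple0/(module_support0P (x := x)) => x1; apply: nx;
    rewrite -(endo_one_dom _ ga) x1 (endo0 ga.1).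
have simc : gr_simple (component S (gcod g)).
  by apply/S_simple0/(module_support0P (x := val a x)); rewrite endo_one_cod.
have hp := endo_hom_component (gdom g) (gcod g) ga.
have [|q [hq qK Kq]] := gr_schur hp simd simc.
  exists (comp_proj (gdom g) x) => /(congr1 val) /=.
  by rewrite (endo_one_dom _ ga) (endo_one_cod _ ga).
have hb := component_endo_hom hq.
exists (Sumtype (sumtype_in (F := endo_family S) hb)); split=> //.
  apply: val_inj; apply/funext => y /=.
  have := congr1 val (Kq (comp_proj (gcod g) y)).
  by rewrite /= (endo_one_cod _ ga).
apply: val_inj; apply/funext => y /=.
have := congr1 val (qK (comp_proj (gdom g) y)).
by rewrite /= (endo_one_dom _ ga).
Qed.

(** The two objects are exchanged because an endomorphism in 1_f (END S) 1_e
    goes from S(e) to S(f). *)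
Lemma END_primality_isoshift e f : module_support0 S e -> module_support0 S f ->
  gr_primality (END S) f e <-> isoshift (component S e) (component S f).
Proof.
move=> se sf; have sime := S_simple0 se; have simf := S_simple0 sf.
split=> [/gr_primality_homP[g [a [ge gf ga na]]]|].
  apply/(isoshift_homP sime simf); have {}ga : endo_hom g (val a) by [].
  exists g, (fun u => comp_proj f (val a (val u))); split.
    exact: endo_hom_component.
  have [x nx] := END_neq0 na; exists (comp_proj e x) => /(congr1 val) /=.
  by rewrite -ge -gf (endo_one_dom _ ga) (endo_one_cod _ ga).
move=> /(isoshift_homP sime simf)[g [p [hp [u nu]]]].
exists (Sumtype (sumtype_in (F := endo_family S) (component_endo_hom hp))).
move=> /(congr1 (fun v : END S => val v (val u))) /=.
have -> : comp_proj e (endo_one e (val u)) = u by rewrite endo_one_val comp_projK.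
by rewrite endo_one_val => pu0; apply: nu; apply: val_inj.
Qed.

End Components.

(** * The theorem *)

Theorem theorem5p3 (G : groupoid) (R : grRing G) (S : grModule R)
    (S_neq0 : exists x : S, x <> 0) (S_simple0 : simple0 S) :
  let D := END S in
  let G0' := ring_support0 D in
  let sim := @gr_primality G D in
  [/\ G0' = module_support0 S,
      (* (1) *)
      gr_division_ring D,
      (* (2) *)
      forall e f, G0' e -> G0' f ->
        (sim e f <-> isoshift (component S e) (component S f)),
      (* (3) *)
      equiv_on G0' sim /\
      exists phi : (gob G -> Prop) -> (grModule R -> Prop),
        bij_on (quotient_by G0' sim)
          (image_of G0' (fun e => isoshift_class (component S e))) phi /\
        forall e, G0' e ->
          phi (eqclass G0' sim e) = isoshift_class (component S e) &
      (* (4) *)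
      let all_isoshift := forall e f, G0' e -> G0' f ->
        isoshift (component S e) (component S f) in
      (gr_prime_ring D <-> all_isoshift) /\ (gr_simple_ring D <-> all_isoshift)].
Proof.
move=> D G0' sim.
have suppE : G0' = module_support0 S by exact: END_support0.
have sim0 e : G0' e -> gr_simple (component S e) by rewrite suppE; apply: S_simple0.
have divD : gr_division_ring D by exact: END_division.
have eqv : equiv_on G0' sim by exact: gr_division_primality_equiv.
have [simR simS simT] := eqv.
have iso e f : G0' e -> G0' f ->
    (sim e f <-> isoshift (component S e) (component S f)).
  move=> Ge Gf; rewrite -END_primality_isoshift -?suppE //.
  by split; apply: simS.
have classE e f : G0' e -> G0' f -> sim e f ->
    isoshift_class (component S e) = isoshift_class (component S f).
  by move=> Ge Gf /(iso _ _ Ge Gf); apply: isoshift_class_eq; apply: sim0.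
split=> //.
  split=> //.
  (* The class of S(e) depends only on the class of e, so the union over the
     members of P defines the map without choosing representatives. *)
  pose phi (P : gob G -> Prop) (N : grModule R) := exists e,
    [/\ G0' e, P e & isoshift_class (component S e) N].
  have phiE e : G0' e ->
      phi (eqclass G0' sim e) = isoshift_class (component S e).
    move=> Ge; apply/funext => N; apply/propext; split=> [[f [Gf [_ ef]]]|eN].
      by rewrite (classE e f).
    by exists e; split=> //; split=> //; apply: simR.
  exists phi; split=> //; split=> [_ [e Ge <-]|_ _ [e Ge <-] [f Gf <-]|_ [e Ge <-]].
  - by exists e => //; rewrite phiE.
  - rewrite !phiE // => ef.
    have : isoshift_class (component S f) (component S f).
      by split; [apply: sim0 | apply/(iso f f) => //; apply: simR].
    rewrite -ef => -[_ /(iso e f Ge Gf) sef].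
    apply/funext => k; apply/propext; split=> -[Gk sk]; split=> //.
      exact: simT Gf Ge Gk (simS _ _ Ge Gf sef) sk.
    exact: simT Ge Gf Gk sef sk.
  - by exists (eqclass G0' sim e); [exists e | apply: phiE].
move=> all_isoshift.
have allE : (forall e f, G0' e -> G0' f -> sim e f) <-> all_isoshift.
  by split=> H e f Ge Gf; apply/(iso e f Ge Gf)/H.
have all_simple : all_isoshift -> gr_simple_ring D.
  by move=> /allE; apply: gr_division_primality_simple.
have prime_all : gr_prime_ring D -> all_isoshift.
  by move=> /gr_prime_ring_primality prim; apply/allE.
have simple_prime := @gr_simple_ring_prime G D.
split; split=> // h; first exact: simple_prime (all_simple h).
exact: prime_all (simple_prime h).
Qed.
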